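(* Assume that $h=c_1n^{-\frac1{2\beta+2}}$ with $c_1>c_0=\left(\frac{\sigma^2(\beta+2)(2\beta+2)}{8L^2\beta}\right)^{\frac1{2\beta+2}}$, or $h\ge c_1n^{-\alpha}$ with $0\le\alpha<\frac1{2\beta+2}$ and $c_1>0$. Suppose that $f$ satisfies the local Hölder condition $$|f(x)-f(y)|\le L\|x-y\|_\infty^\beta,\qquad \forall x,y\in\mathbf U_{x_0,h},$$ that $\rho(x)=|f(x)-f(x_0)|+\delta_n$ for $x\in\mathbf U_{x_0,h}$, where $\delta_n\ge0$ is deterministic, and that $\delta_n=O\big(n^{-\frac{\beta}{2+2\beta}}\big)$. Then $$\mathbb E\left(f_h^*(x_0)-f(x_0)\right)^2=O\left(n^{-\frac{2\beta}{2+2\beta}}\right).$$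
   Context: For a positive integer $N$ put $n=N^2$ and $\mathbf I=\{\frac1N,\frac2N,\dots,\frac{N-1}N,1\}^2$. One observes $Y(x)=f(x)+\varepsilon(x)$, $x\in\mathbf I$, where $f:[0,1]^2\to[0,\infty)$ is an unknown function and $(\varepsilon(x))_{x\in\mathbf I}$ are i.i.d. Gaussian with mean $0$ and standard deviation $\sigma>0$. For $x_0\in\mathbf I$ and $h>0$ (taken as a multiple of $1/N$), $\mathbf U_{x_0,h}=\{x\in\mathbf I:\|x-x_0\|_\infty\le h\}$, with $\|\cdot\|_\infty$ the supremum norm on $\mathbb R^2$. $L>0$ and $\beta>0$ are constants. For a non-negative function $\rho$ on $\mathbf U_{x_0,h}$ let $$w_\rho(x)=\frac{K_{\mathrm{tr}}(\rho(x)/a)}{\sum_{y\in\mathbf U_{x_0,h}}K_{\mathrm{tr}}(\rho(y)/a)},\qquad x\in\mathbf U_{x_0,h},$$ where $K_{\mathrm{tr}}(t)=(1-|t|)^+$, $t^+=\max(t,0)$, and $a>0$ is the unique solution on $(0,\infty)$ of $\sum_{x\in\mathbf U_{x_0,h}}\rho(x)(a-\rho(x))^+=\sigma^2$. These are the weights that minimize $\big(\sum_{x}w(x)\rho(x)\big)^2+\sigma^2\sum_{x}w(x)^2$ over $w\ge0$ with $\sum_x w(x)=1$ (sums over $\mathbf U_{x_0,h}$). The estimator is $$f_h^*(x_0)=\sum_{x\in\mathbf U_{x_0,h}}w_\rho(x)Y(x).$$ Convention: $O(a_n)$ denotes a number bounded by $c\cdot a_n$ for some constant $c>0$; all constants $c$,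 $c_i$ are positive and depend only on $L$, $\beta$ and $\sigma$. *)

(* Defs.v *)
From HB Require Import structures.
From mathcomp Require Import all_boot all_order all_algebra.
From mathcomp Require Import all_classical all_reals all_analysis.

Set Implicit Arguments.
Unset Strict Implicit.
Unset Printing Implicit Defensive.

Import Order.TTheory GRing.Theory Num.Theory.
Import numFieldNormedType.Exports.

Local Open Scope classical_set_scope.
Local Open Scope ring_scope.

Notation grid N := ('I_N * 'I_N)%type.

(* The design point of index (i, j), counted from 0, is ((i+1)/N, (j+1)/N). *)
Definition gpt (R : realType) (N : nat) (x : grid N) : R * R :=
  ((x.1.+1)%:R / N%:R, (x.2.+1)%:R / N%:R).

(* The canonical norm on the product R * R is the supremum norm. *)
Definition gdist (R : realType) (N : nat) (x y : grid N) : R :=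
  `| gpt R x - gpt R y |.

(* The radius h is an arbitrary real.  Coordinates of design points differ by
   multiples of 1/N, so h and its rounding down to a multiple of 1/N define the
   same neighbourhood. *)
Definition nbhd (R : realType) (N : nat) (x0 : grid N) (h : R) : {set grid N} :=
  [set x | gdist R x x0 <= h]%SET.

Definition Ktr (R : realType) (t : R) : R := Num.max (1 - `|t|) 0.

Definition bandwidth_sol (R : realType) (N : nat) (sigma : R) (U : {set grid N})
    (rho : grid N -> R) : set R :=
  [set a | 0 < a /\
     \sum_(x in U) rho x * Num.max (a - rho x) 0 = sigma ^+ 2].

(* A solution exists, and is unique, unless rho vanishes identically on U; in
   that case Ktr (rho x / a) = 1 for every a, so whatever the default value the
   weights below are uniform on U, which is the minimizer of the sum of squared
   bias bound and variance. *)
Definition bandwidth (R : realType) (N : nat) (sigma : R) (U : {set grid N})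
    (rho : grid N -> R) : R :=
  xget 1 (bandwidth_sol sigma U rho).

Definition weight (R : realType) (N : nat) (sigma : R) (U : {set grid N})
    (rho : grid N -> R) (x : grid N) : R :=
  let a := bandwidth sigma U rho in
  Ktr (rho x / a) / \sum_(y in U) Ktr (rho y / a).

Definition estimator (R : realType) (N : nat) (sigma h : R) (x0 : grid N)
    (rho Y : grid N -> R) : R :=
  \sum_(x in nbhd x0 h) weight sigma (nbhd x0 h) rho x * Y x.

Definition observation (R : realType) (N : nat) (T : Type) (f : R * R -> R)
    (eps : grid N -> T -> R) (x : grid N) (t : T) : R :=
  f (gpt R x) + eps x t.

Definition mutually_independent (d : measure_display) (T : measurableType d)
    (R : realType) (P : probability T R) (I : finType)
    (X : I -> {RV P >-> R}) : Prop :=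
  forall (J : {set I}) (B : I -> set R),
    (forall i, i \in J -> measurable (B i)) ->
    P (\bigcap_(i in [set` J]) (X i @^-1` B i)) =
    (\prod_(i in J) P (X i @^-1` B i))%E.

Definition iid_gaussian (d : measure_display) (T : measurableType d)
    (R : realType) (P : probability T R) (I : finType) (sigma : R)
    (eps : I -> {RV P >-> R}) : Prop :=
  mutually_independent eps /\
  forall (i : I) (B : set R), measurable B ->
    distribution P (eps i) B = normal_prob 0 sigma B.

Definition c0 (R : realType) (L beta sigma : R) : R :=
  (sigma ^+ 2 * (beta + 2) * (2 * beta + 2) / (8 * L ^+ 2 * beta))
    `^ (1 / (2 * beta + 2)).

(* Main.v *)
(** The mean squared error of the estimator is the squared bias plus the noise
    second moment times the sum of the squared weights.  As [rho] dominates
    [|f x - f x0|], it is at most a constant times the objective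
    [(sum w rho)^2 + sigma^2 sum w^2], which the weights [w_rho] minimize over
    all weights on the neighbourhood.  Comparing with uniform weights on the
    smaller neighbourhood of radius [r = min(c1, 1) n^(-1/(2 beta + 2)) <= h],
    which has at least [n r^2] points, gives the rate.  The noise enters only
    through centring, pairwise uncorrelatedness and a finite second moment. *)

Require Import Defs.
From HB Require Import structures.
From mathcomp Require Import all_boot all_order all_algebra.
From mathcomp Require Import all_classical all_reals all_analysis.
From mathcomp Require Import measurable_realfun zify ring lra.

Set Implicit Arguments.
Unset Strict Implicit.
Unset Printing Implicit Defensive.

Import Order.TTheory GRing.Theory Num.Theory.
Import numFieldNormedType.Exports.

Local Open Scope classical_set_scope.
Local Open Scope ring_scope.

(** * Moments of the centred Gaussian law *)

Section normal_moments.
Context {R : realType}.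
Local Notation mu := (@lebesgue_measure R).

(** The Radon-Nikodym derivative of [normal_prob] and [normal_pdf] have the same integral over every
    measurable set, hence agree almost everywhere and are interchangeable under the integral. *)
Lemma ge0_integral_normal_prob (m s : R) (f : R -> \bar R) :
  measurable_fun setT f -> (forall x, (0 <= f x)%E) ->
  (\int[normal_prob m s]_x f x = \int[mu]_x (f x * (normal_pdf m s x)%:E))%E.
Proof.
move=> mf f0; have dom := normal_prob_dominates m s.
have mpdf : measurable_fun setT (fun x => (normal_pdf m s x)%:E).
  by apply/measurable_EFinP; exact: measurable_normal_pdf.
rewrite -(Radon_Nikodym_SigmaFinite.change_of_variables dom)//.
have mRN := measurable_int _ (Radon_Nikodym_SigmaFinite.f_integrable dom).
apply: ge0_ae_eq_integral => //.
- exact: emeasurable_funM.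
- exact: emeasurable_funM.
- by move=> x _; rewrite mule_ge0// Radon_Nikodym_SigmaFinite.f_ge0.
- by move=> x _; rewrite mule_ge0// lee_fin normal_pdf_ge0.
apply: ae_eqe_mul2l; apply: integral_ae_eq => //.
  exact: Radon_Nikodym_SigmaFinite.f_integrable.
by move=> E _ mE; rewrite -Radon_Nikodym_SigmaFinite.f_integral.
Qed.

(** Doubling the standard deviation leaves enough room in the exponent to absorb the factor
    [x ^+ 2]: the integrand is at most a constant times the wider density, whose integral is 1. *)
Lemma normal_second_moment_lty (s : R) : s != 0 ->
  (\int[normal_prob 0 s]_x (x ^+ 2)%:E < +oo)%E.
Proof.
move=> s0; have s20 : 0 < s ^+ 2 by rewrite exprn_even_gt0.
have d0 : 2 * s != 0 by rewrite mulf_neq0.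
have msqr : measurable_fun setT (fun x : R => (x ^+ 2)%:E).
  by apply/measurable_EFinP; exact: measurable_funX.
rewrite ge0_integral_normal_prob//; last by move=> x; rewrite lee_fin sqr_ge0.
(* With [u = 3 x^2 / (8 s^2)], the gap between the two exponents, one has [x^2 = 8/3 s^2 u] and
   [u exp(-u) <= 1]; the quotient of peaks adjusts the normalisation. *)
pose K := 8 / 3 * s ^+ 2 * normal_peak s / normal_peak (2 * s).
apply: (@le_lt_trans _ _ (\int[mu]_x (K%:E * (normal_pdf 0 (2 * s) x)%:E))%E);
  last first.
  rewrite integralZl//; last exact: integrable_normal_pdf.
  by rewrite integral_normal_pdf mule1 ltry.
apply: ge0_le_integral => //.
- by move=> x _; rewrite -EFinM lee_fin mulr_ge0// ?sqr_ge0 ?normal_pdf_ge0.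
- apply: emeasurable_funM => //.
  by apply/measurable_EFinP; exact: measurable_normal_pdf.
- apply: emeasurable_funM => //.
  by apply/measurable_EFinP; exact: measurable_normal_pdf.
move=> x _; rewrite -!EFinM lee_fin !normal_pdfE// /normal_fun subr0.
have pk := normal_peak_gt0 s0; have pk2 := normal_peak_gt0 d0.
rewrite mulrCA.
have -> y : K * (normal_peak (2 * s) * y) = normal_peak s * (8 / 3 * s ^+ 2 * y).
  by rewrite /K; field; rewrite gt_eqF.
rewrite ler_pM2l//.
set u := 3 / 8 * (x ^+ 2 / s ^+ 2).
have -> : - x ^+ 2 / (s ^+ 2 *+ 2) = - u + - x ^+ 2 / ((2 * s) ^+ 2 *+ 2).
  rewrite /u; field; exact: s0.
rewrite expRD mulrA ler_pM2r ?expR_gt0// expRN ler_pdivrMr ?expR_gt0//.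
have -> : x ^+ 2 = 8 / 3 * s ^+ 2 * u by rewrite /u; field; exact: s0.
rewrite ler_pM2l; last by rewrite mulr_gt0.
by apply: le_trans (expR_ge1Dx u); rewrite lerDr.
Qed.

(** Cutting the line at 0 and reflecting the negative half turns both sides into the same two
    integrals over the nonnegative half-line, in opposite order. *)
Lemma ge0_integralT_opp (g : R -> R) : (forall x, 0 <= g x) -> continuous g ->
  (\int[mu]_x (g x)%:E = \int[mu]_x (g (- x))%:E)%E.
Proof.
move=> g0 cg.
have cgN : continuous (g \o -%R).
  by move=> x; apply: continuous_comp; [exact: continuousN|exact: cg].
have split (f : R -> R) : (forall x, 0 <= f x) -> continuous f ->
    (\int[mu]_x (f x)%:E =
     \int[mu]_(x in `[0%R, +oo[) (f x)%:E +
     \int[mu]_(x in `[0%R, +oo[) (f (- x))%:E)%E.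
  move=> f0 cf; have mf := continuous_measurable_fun cf.
  rewrite -(setUv `[0%R, +oo[%classic) ge0_integral_setU//=; last 4 first.
  - exact: measurableC.
  - by apply/measurable_EFinP; rewrite setUv.
  - by move=> x _; rewrite lee_fin.
  - exact/disj_setPCl.
  congr (_ + _)%E; rewrite setCitvr.
  rewrite integral_itv_bndo_bndc; last exact/measurable_EFinP/measurable_funTS.
  rewrite -{1}oppr0 ge0_integration_by_substitutionNy//.
  exact: continuous_subspaceT.
rewrite (split g)// (split (g \o -%R) (fun x => g0 (- x)) cgN) addeC.
congr (_ + _)%E.
by apply: eq_integral => x _ /=; rewrite opprK.
Qed.

Lemma normal_integrable_id (s : R) : s != 0 ->
  (normal_prob 0 s).-integrable setT EFin.
Proof.
move=> s0; apply/integrableP; split; first exact/measurable_EFinP.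
have msqr : measurable_fun setT (fun x : R => (x ^+ 2)%:E).
  by apply/measurable_EFinP; exact: measurable_funX.
apply: (@le_lt_trans _ _ (\int[normal_prob 0 s]_x ((x ^+ 2)%:E + 1%:E))%E).
  apply: ge0_le_integral => //.
  - by apply: measurableT_comp => //; exact/measurable_EFinP.
  - by apply: emeasurable_funD => //; exact: measurable_cst.
  move=> x _; rewrite /= -EFinD lee_fin -real_normK ?num_real//.
  by have := sqr_ge0 (`|x| - 2^-1); lra.
rewrite ge0_integralD//.
- by rewrite lte_add_pinfty ?normal_second_moment_lty// integral_cst//=
    mul1e probability_setT ltry.
- by move=> x _; rewrite lee_fin sqr_ge0.
Qed.

(** The density is even, so reflection exchanges the positive and negative parts of the identity.
    Their common integral is finite, so the difference is 0. *)
Lemma normal_mean0 (s : R) : s != 0 ->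
  (\int[normal_prob 0 s]_x x%:E = 0)%E.
Proof.
move=> s0; have iid := normal_integrable_id s0.
have fin := integrable_pos_fin_num measurableT iid.
have mid : measurable_fun setT (EFin : R -> \bar R) by exact/measurable_EFinP.
rewrite integralE; apply/eqP; rewrite sube_eq ?fin_num_adde_defr// add0e; apply/eqP.
rewrite !ge0_integral_normal_prob//; last 2 first.
- exact: measurable_funeneg.
- exact: measurable_funepos.
pose g (x : R) := Num.max x 0 * normal_pdf 0 s x.
transitivity (\int[mu]_x (g x)%:E)%E.
  by apply: eq_integral => x _; rewrite funeposE -EFin_max -EFinM.
rewrite ge0_integralT_opp.
- apply: eq_integral => x _; rewrite funenegE /= -EFin_max -EFinM /g.
  by rewrite !normal_pdfE// /normal_fun !subr0 sqrrN.
- by move=> x; rewrite mulr_ge0 ?normal_pdf_ge0// le_max lexx orbT.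
move=> x; apply: cvgM; last exact: continuous_normal_pdf.
by apply: continuous_max; [exact: cvg_id|exact: cvg_cst].
Qed.

End normal_moments.

(** * Second-order calculus of random variables *)

Section second_order.
Context d (T : measurableType d) (R : realType) (P : probability T R).
Local Open Scope ereal_scope.

(** The law of the pair agrees with the product of the marginal laws on rectangles, hence everywhere
    by uniqueness of the product measure; Fubini then separates the factors. *)
Lemma integralM_indep (X Y : {RV P >-> R}) :
  (forall A B, measurable A -> measurable B ->
    P (X @^-1` A `&` Y @^-1` B) = P (X @^-1` A) * P (Y @^-1` B)) ->
  P.-integrable setT (EFin \o X) -> P.-integrable setT (EFin \o Y) ->
  P.-integrable setT (fun t => (X t * Y t)%:E) ->
  \int[P]_t (X t * Y t)%:E = \int[P]_t (X t)%:E * \int[P]_t (Y t)%:E.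
Proof.
move=> indep iX iY iXY.
have mXY : measurable_fun setT (fun t => (X t, Y t)).
  exact: measurable_fun_pair.
pose XY : {mfun T >-> (R * R)%type} :=
  HB.pack (fun t => (X t, Y t)) (isMeasurableFun.Build _ _ _ _ _ mXY).
pose f (z : R * R) := (z.1 * z.2)%:E.
have mf : measurable_fun setT f.
  by apply/measurable_EFinP; apply: measurable_funM.
have lawE A : measurable A ->
    (distribution P X \x distribution P Y) A = distribution P XY A.
  by apply: product_measure_unique => B C mB mC; rewrite -indep.
have iprod : (distribution P X \x distribution P Y).-integrable setT f.
  apply/integrableP; split => //.
  rewrite (eq_measure_integral (distribution P XY)); last first.
    by move=> A mA _; exact: lawE.
  rewrite ge0_integral_distribution//; last exact: measurableT_comp.
  by move/integrableP: iXY => [].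
have -> : \int[P]_t (X t * Y t)%:E = \int[distribution P XY]_z f z.
  by rewrite integral_distribution.
have -> : \int[distribution P XY]_z f z =
    \int[distribution P X \x distribution P Y]_z f z.
  by apply: eq_measure_integral => A mA _; exact/esym/lawE.
rewrite -integral12_prod_meas1// /fubini_F /f /=.
have iXd : (distribution P X).-integrable setT (EFin : R -> \bar R).
  by apply: integrable_pushforward => //; exact/measurable_EFinP.
have iYd : (distribution P Y).-integrable setT (EFin : R -> \bar R).
  by apply: integrable_pushforward => //; exact/measurable_EFinP.
have mEFin : measurable_fun setT (EFin : R -> \bar R) by exact/measurable_EFinP.
under eq_integral => x _.
  under eq_integral do rewrite EFinM.
  rewrite integralZl// integral_distribution//.
  over.
rewrite -[X in _ * X]fineK; last exact: integrable_fin_num.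
under eq_integral do rewrite -[X in _ * X]fineK ?integrable_fin_num//.
by rewrite integralZr// integral_distribution.
Qed.

Lemma integrable_of_sqr (X : {RV P >-> R}) :
  P.-integrable setT (fun t => (X t ^+ 2)%:E) -> P.-integrable setT (EFin \o X).
Proof.
move=> i2; apply: (@le_integrable _ _ _ _ _ _ _ (fun t => (X t ^+ 2)%:E + 1)) => //.
- exact/measurable_EFinP.
- move=> t _; rewrite /= lee_fin.
  rewrite [leRHS]ger0_norm ?addr_ge0 ?sqr_ge0// -real_normK ?num_real//.
  by have := sqr_ge0 (`|X t| - 2^-1)%R; lra.
by apply: integrableD => //; exact: finite_measure_integrable_cst.
Qed.

Lemma integrable_mul_of_sqr (X Y : {RV P >-> R}) :
  P.-integrable setT (fun t => (X t ^+ 2)%:E) ->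
  P.-integrable setT (fun t => (Y t ^+ 2)%:E) ->
  P.-integrable setT (fun t => (X t * Y t)%:E).
Proof.
move=> iX iY; apply: (@le_integrable _ _ _ _ _ _ _
  (fun t => (X t ^+ 2)%:E + (Y t ^+ 2)%:E)) => //.
- by apply/measurable_EFinP; exact: measurable_funM.
- move=> t _; rewrite /= lee_fin.
  rewrite [leRHS]ger0_norm ?addr_ge0 ?sqr_ge0// normrM.
  rewrite -[(X t ^+ 2)%R]real_normK ?num_real// -[(Y t ^+ 2)%R]real_normK ?num_real//.
  by have := sqr_ge0 (`|X t| - `|Y t|)%R; have := sqr_ge0 (`|X t| + `|Y t|)%R; lra.
exact: integrableD.
Qed.

(** Expanding the square, the linear terms vanish by centring and the off-diagonal products by
    uncorrelatedness. Every term is integrable because the second moments equal the real [v]. *)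
Lemma expectation_sqr_affine (I : finType) (U : {set I})
    (e : I -> {RV P >-> R}) (w : I -> R) (b v : R) :
  (forall i, \int[P]_t (e i t)%:E = 0) ->
  (forall i, \int[P]_t (e i t ^+ 2)%:E = v%:E) ->
  (forall i j, i != j -> \int[P]_t (e i t * e j t)%:E = 0) ->
  'E_P[fun t => ((b + \sum_(i in U) w i * e i t) ^+ 2)%R] =
  (b ^+ 2 + v * \sum_(i in U) w i ^+ 2)%:E.
Proof.
move=> m1 m2 cov.
have i2 i : P.-integrable setT (fun t => (e i t ^+ 2)%:E).
  apply/integrableP; split; first by apply/measurable_EFinP; exact: measurable_funX.
  under eq_integral do rewrite gee0_abs ?lee_fin ?sqr_ge0//.
  by rewrite m2 ltry.
have i1 i : P.-integrable setT (fun t => (e i t)%:E).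
  exact: (integrable_of_sqr (i2 i)).
have i11 i j := integrable_mul_of_sqr (i2 i) (i2 j).
have iL i : P.-integrable setT (fun t => (2 * b * w i)%:E * (e i t)%:E).
  exact: (integrableZl measurableT _ (i1 i)).
have iQ i j : P.-integrable setT (fun t => (w i * w j)%:E * (e i t * e j t)%:E).
  exact: (integrableZl measurableT _ (i11 i j)).
have iQs i : P.-integrable setT
    (fun t => \sum_(j in U) (w i * w j)%:E * (e i t * e j t)%:E)%E.
  exact: integrable_sum.
have ic : P.-integrable setT (cst (b ^+ 2)%:E).
  exact: finite_measure_integrable_cst.
rewrite unlock; transitivity (\int[P]_t ((b ^+ 2)%:E +
    (\sum_(i in U) (2 * b * w i)%:E * (e i t)%:E +
     \sum_(i in U) \sum_(j in U) (w i * w j)%:E * (e i t * e j t)%:E))).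
  apply: eq_integral => t _.
  under [X in _ = _ + (X + _)]eq_bigr do rewrite -EFinM.
  under [X in _ = _ + (_ + X)]eq_bigr => i _.
    under eq_bigr do rewrite -EFinM.
    rewrite sumEFin; over.
  rewrite !sumEFin -!EFinD; congr EFin.
  have -> : (\sum_(i in U) \sum_(j in U) w i * w j * (e i t * e j t) =
      (\sum_(i in U) w i * e i t) ^+ 2)%R.
    rewrite expr2 mulr_suml; apply: eq_bigr => i _.
    by rewrite mulr_sumr; apply: eq_bigr => j _; rewrite mulrACA.
  have -> : (\sum_(i in U) 2 * b * w i * e i t =
      2 * b * \sum_(i in U) w i * e i t)%R.
    by rewrite mulr_sumr; apply: eq_bigr => i _; rewrite mulrA.
  by ring.
rewrite integralD//; last first.
  by apply: integrableD => //; exact: integrable_sum.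
rewrite integralD//; [|exact: integrable_sum..].
rewrite !integral_sum// integral_cst//= probability_setT mule1.
rewrite [X in _ + (X + _)]big1; last first.
  by move=> i _; rewrite integralZl// m1 mule0.
rewrite add0e EFinD; congr (_ + _); rewrite mulr_sumr -sumEFin.
apply: eq_bigr => i iU; rewrite integral_sum// (bigD1 i)//= big1; last first.
  by move=> j /andP[_ ji]; rewrite integralZl// cov ?mule0// eq_sym.
rewrite adde0 integralZl//; under eq_integral do rewrite -expr2.
by rewrite m2 -EFinM -expr2 mulrC.
Qed.

End second_order.

(** * Existence of the bandwidth and optimality of the weights *)

Lemma continuous_sumr (R : realType) (I : finType) (A : {set I})
    (f : I -> R -> R) :
  (forall i, continuous (f i)) -> continuous (fun a => \sum_(i in A) f i a).
Proof.
move=> cf; have -> : (fun a => \sum_(i in A) f i a) = \sum_(i in A) f i.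
  by apply/funext => a; rewrite fct_sumE.
apply: (big_ind (fun g : R -> R => continuous g)) => //.
- by move=> x; exact: cvg_cst.
- by move=> g1 g2 c1 c2 x; apply: cvgD; [exact: c1|exact: c2].
Qed.

Section weights.
Context {R : realType} (N : nat) (sigma : R) (sigma_gt0 : 0 < sigma).
Implicit Types (U V : {set grid N}) (rho v : grid N -> R).

Definition risk_bound U rho v : R :=
  (\sum_(x in U) v x * rho x) ^+ 2 + sigma ^+ 2 * \sum_(x in U) v x ^+ 2.

(** Intermediate value theorem for the left-hand side of the bandwidth equation, a continuous
    function of [a]. *)
Lemma bandwidth_sol_exists U rho x1 : (forall x, x \in U -> 0 <= rho x) ->
  x1 \in U -> 0 < rho x1 -> exists a, bandwidth_sol sigma U rho a.
Proof.
move=> rho0 x1U rho1.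
pose F a := \sum_(x in U) rho x * Num.max (a - rho x) 0.
have F0 : F 0 = 0.
  rewrite /F big1// => x xU; rewrite sub0r.
  by have /max_idPr -> : - rho x <= 0; [rewrite oppr_le0 rho0|rewrite mulr0].
have cF : continuous F.
  apply: continuous_sumr => x a; apply: cvgM; first exact: cvg_cst.
  apply: (@continuous_max _ _ (fun b => b - rho x) (cst 0)); last exact: cvg_cst.
  by apply: (@cvgB _ R^o); [exact: cvg_id|exact: cvg_cst].
(* Chosen so that the term of index [x1] alone already equals [sigma ^+ 2] at [b]. *)
pose b := rho x1 + sigma ^+ 2 / rho x1.
have s2 : 0 < sigma ^+ 2 by rewrite exprn_gt0.
have b0 : 0 < b by rewrite addr_gt0// divr_gt0.
have Fb : sigma ^+ 2 <= F b.
  rewrite /F (bigD1 x1)//= /b addrAC subrr add0r.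
  have /max_idPl -> : 0 <= sigma ^+ 2 / rho x1 by rewrite ltW// divr_gt0.
  rewrite mulrCA divff ?gt_eqF// mulr1 lerDl sumr_ge0// => x /andP[xU _].
  by rewrite mulr_ge0 ?rho0// le_max lexx orbT.
have [] := @IVT R F 0 b (sigma ^+ 2) (ltW b0).
- exact: continuous_subspaceT.
- by rewrite F0 ge_min le_max ltW// Fb orbT.
move=> a /[!in_itv]/= /andP[a0 _] Fa; exists a; split => //.
(* The theorem only places [a] in a closed interval; [a = 0] is excluded because
   [F 0 = 0 < sigma ^+ 2]. *)
by rewrite lt_neqAle a0 andbT; apply: contraTneq s2 => a00; rewrite -Fa -a00 F0 ltxx.
Qed.

Lemma Ktr_divE (a t : R) : 0 < a -> 0 <= t -> Ktr (t / a) = Num.max (a - t) 0 / a.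
Proof.
move=> a0 t0; rewrite /Ktr ger0_norm ?divr_ge0 ?(ltW a0)//.
rewrite maxr_pMl ?invr_ge0 ?(ltW a0)// mul0r; congr Num.max.
by rewrite mulrBl divff// gt_eqF.
Qed.

(** Were this sum of nonnegative terms 0, each term would vanish, and with them the left-hand side
    of the bandwidth equation. Up to the factor [a], the sum is the denominator of the weights. *)
Lemma bandwidth_sol_sum_gt0 U rho a : bandwidth_sol sigma U rho a ->
  0 < \sum_(x in U) Num.max (a - rho x) 0.
Proof.
have s2 : 0 < sigma ^+ 2 by rewrite exprn_gt0.
have p0 x : 0 <= Num.max (a - rho x) 0 by rewrite le_max lexx orbT.
move=> [_ solE]; rewrite lt_neqAle sumr_ge0// andbT eq_sym.
apply: contraTneq s2 => S0; rewrite -solE big1 ?ltxx// => x xU.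
by rewrite (psumr_eq0P (fun x _ => p0 x) S0 xU) mulr0.
Qed.

Lemma bandwidthP U rho : (forall x, x \in U -> 0 <= rho x) ->
  (exists2 x, x \in U & 0 < rho x) ->
  bandwidth_sol sigma U rho (bandwidth sigma U rho).
Proof.
by move=> rho0 [x xU rhox]; apply: (xgetPex 1); exact: bandwidth_sol_exists rhox.
Qed.

Lemma Ktr_sum_gt0 U rho x0 : (forall x, x \in U -> 0 <= rho x) -> x0 \in U ->
  0 < \sum_(x in U) Ktr (rho x / bandwidth sigma U rho).
Proof.
move=> rho0 x0U; have [rhopos|rhoz] := pselect (exists2 x, x \in U & 0 < rho x).
  have sol := bandwidthP rho0 rhopos; have [a0 _] := sol.
  rewrite (eq_bigr _ (fun x xU => Ktr_divE a0 (rho0 x xU))) -mulr_suml.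
  by rewrite divr_gt0// bandwidth_sol_sum_gt0.
(* Here [rho] vanishes on [U]: the kernel is 1 there whatever the default bandwidth, and the sum is
   the cardinality of [U]. *)
rewrite (eq_bigr (fun=> 1)); last first.
  move=> x xU; suff -> : rho x = 0.
    by rewrite /Ktr mul0r normr0 subr0; apply/max_idPl.
  apply/eqP; rewrite eq_le rho0// andbT leNgt; apply/negP => rx.
  by apply: rhoz; exists x.
by rewrite sumr_const ltr0n; apply/card_gt0P; exists x0.
Qed.

Lemma weight_ge0 U rho x : 0 <= weight sigma U rho x.
Proof.
have K0 (t : R) : 0 <= Ktr t by rewrite le_max lexx orbT.
by rewrite divr_ge0// sumr_ge0.
Qed.

Lemma weight_sum1 U rho x0 : (forall x, x \in U -> 0 <= rho x) -> x0 \in U ->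
  \sum_(x in U) weight sigma U rho x = 1.
Proof.
by move=> rho0 x0U; rewrite -mulr_suml divff// gt_eqF// (Ktr_sum_gt0 rho0 x0U).
Qed.

(* Let [g] be half the gradient of the quadratic form [risk_bound] at the
   claimed optimum [w].  Then [g >= c] pointwise with [c = risk_bound w], hence
   [c <= sum g v], the polar form at [(w, v)], which AM-GM bounds by
   [(risk_bound w + risk_bound v) / 2]. *)
Lemma weight_optimal U rho v x0 : (forall x, x \in U -> 0 <= rho x) ->
  x0 \in U -> (forall x, x \in U -> 0 <= v x) -> \sum_(x in U) v x = 1 ->
  risk_bound U rho (weight sigma U rho) <= risk_bound U rho v.
Proof.
move=> rho0 x0U v0 v1.
have s2 : 0 < sigma ^+ 2 by rewrite exprn_gt0.
have optimal_if (w : grid N -> R) c : risk_bound U rho w = c ->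
    (forall x, x \in U -> c <=
      (\sum_(y in U) w y * rho y) * rho x + sigma ^+ 2 * w x) ->
    risk_bound U rho w <= risk_bound U rho v.
  move=> wc cle; set bw := \sum_(y in U) _ in cle.
  have cross : c <= bw * (\sum_(x in U) v x * rho x) +
                    sigma ^+ 2 * \sum_(x in U) w x * v x.
    rewrite -[c]mulr1 -v1 !mulr_sumr -big_split/=; apply: ler_sum => x xU.
    rewrite (le_trans (ler_wpM2r (v0 x xU) (cle x xU)))//.
    by rewrite le_eqVlt; apply/orP; left; apply/eqP; ring.
  (* The sum of the two risks minus twice the polar form is [(bw - bv)^2 + sigma^2 * sum (w - v)^2],
     where [bv] is the bias bound of [v]. *)
  have sq : 0 <= \sum_(x in U) (w x - v x) ^+ 2.
    by apply: sumr_ge0 => x _; exact: sqr_ge0.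
  have sqE : \sum_(x in U) (w x - v x) ^+ 2 = \sum_(x in U) w x ^+ 2 -
      2 * (\sum_(x in U) w x * v x) + \sum_(x in U) v x ^+ 2.
    rewrite mulr_sumr -sumrB -big_split/=; apply: eq_bigr => x _; ring.
  move: sq; rewrite sqE => sq.
  have := sqr_ge0 (bw - \sum_(x in U) v x * rho x).
  move: wc cross; rewrite /risk_bound -/bw.
  have := mulr_ge0 (ltW s2) sq.
  set a1 := \sum_(x in U) w x ^+ 2; set a2 := \sum_(x in U) _ * v x.
  set a3 := \sum_(x in U) v x ^+ 2; set bv := \sum_(x in U) v x * rho x.
  nra.
have [rhopos|rhoz] := pselect (exists2 x1, x1 \in U & 0 < rho x1).
- have sol := bandwidthP rho0 rhopos; have [a0 solE] := sol.
  set a := bandwidth sigma U rho in sol a0 solE.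
  pose p x := Num.max (a - rho x) 0.
  pose S := \sum_(x in U) p x.
  have S0 : 0 < S := bandwidth_sol_sum_gt0 sol.
  have wE x : x \in U -> weight sigma U rho x = p x / S.
    move=> xU; rewrite /weight -/a Ktr_divE ?rho0//.
    rewrite (eq_bigr _ (fun y yU => Ktr_divE a0 (rho0 y yU))) -mulr_suml -/S -/(p x).
    by field; rewrite !gt_eqF.
  have bE : \sum_(x in U) weight sigma U rho x * rho x = sigma ^+ 2 / S.
    rewrite -solE mulr_suml; apply: eq_bigr => x xU.
    by rewrite wE// /p; ring.
  (* The half-gradient at [x] is [sigma^2 / S * (rho x + p x)], and [rho x + p x] is the maximum of
     [a] and [rho x]. *)
  apply: (optimal_if _ (a * sigma ^+ 2 / S)).
  (* Either [p x = 0] or [p x = a - rho x]. Summed over [U], this identity and the bandwidth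
     equation give [sum p^2 = a S - sigma^2]. *)
  + have pp x : p x * p x = a * p x - rho x * p x.
      rewrite -mulrBl /p; case: (leP (a - rho x) 0) => _; first by rewrite !mulr0.
      by [].
    rewrite /risk_bound bE.
    have -> : \sum_(x in U) weight sigma U rho x ^+ 2 =
        (a * S - sigma ^+ 2) / S ^+ 2.
      rewrite -[in RHS]solE mulr_sumr -sumrB mulr_suml; apply: eq_bigr => x xU.
      by rewrite wE// exprMn exprVn expr2 pp.
    by field; rewrite gt_eqF.
  + move=> x xU; rewrite bE wE//.
    have : a <= rho x + p x by rewrite -lerBlDl le_max lexx.
    move=> ap; have := ler_wpM2r (ltW (divr_gt0 s2 S0)) ap.
    by rewrite mulrA => /le_trans; apply; rewrite le_eqVlt; apply/orP; left;
      apply/eqP; ring.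
(* Degenerate case: the weights are uniform, the bias term is 0, and the gradient condition holds
   with equality. *)
have {}rhoz x : x \in U -> rho x = 0.
  move=> xU; apply/eqP; rewrite eq_le rho0// andbT leNgt; apply/negP => rx.
  by apply: rhoz; exists x.
have U0 : (0 < #|U|)%N by apply/card_gt0P; exists x0.
have wE x : x \in U -> weight sigma U rho x = #|U|%:R^-1.
  move=> xU; have K1 y : y \in U -> Ktr (rho y / bandwidth sigma U rho) = 1.
    by move=> yU; rewrite /Ktr rhoz// mul0r normr0 subr0; apply/max_idPl.
  by rewrite /weight (eq_bigr _ K1) K1// sumr_const mul1r.
have bE : \sum_(x in U) weight sigma U rho x * rho x = 0.
  by rewrite big1// => x xU; rewrite rhoz// mulr0.
apply: (optimal_if _ (sigma ^+ 2 / #|U|%:R)).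
  rewrite /risk_bound bE (eq_bigr (fun=> #|U|%:R^-1 ^+ 2)); last first.
    by move=> x xU; rewrite wE.
  rewrite sumr_const -mulr_natr; field; by rewrite pnatr_eq0 -lt0n.
by move=> x xU; rewrite bE wE// mul0r add0r.
Qed.

End weights.

(** * Counting design points in a neighbourhood *)

Section neighbourhood.
Context {R : realType} (N : nat).

(** Near an end of the range the ball loses one side, but a window of [k + 1 > N r] consecutive
    indices containing [i0] still fits, or else the whole range does, which is enough since
    [r <= 1]. *)
Lemma card_ball_ord (i0 : 'I_N) (r : R) : 0 <= r <= 1 ->
  N%:R * r <=
  #|[set i : 'I_N | `|i.+1%:R / N%:R - i0.+1%:R / N%:R| <= r]%SET|%:R.
Proof.
move=> /andP[r0 r1]; have i0N := ltn_ord i0.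
have N0 : 0 < N%:R :> R by rewrite ltr0n (leq_ltn_trans _ i0N).
have Nr0 : 0 <= N%:R * r by rewrite mulr_ge0.
have /andP[kle klt] := truncn_itv Nr0; set k := Num.truncn _ in kle klt.
(* The window of length [m] starts at [i0] unless it would overrun the range, in which case it is
   pushed left to end at the last index; it contains [i0] either way. *)
pose m := minn N k.+1; pose s := minn i0 (N - m).
have sN (j : 'I_m) : (s + j < N)%N by have := ltn_ord j; rewrite /s /m; lia.
pose g j := Ordinal (sN j).
have ginj : injective g.
  by move=> j j' /(congr1 val)/= /addnI/val_inj.
apply: (@le_trans _ _ m%:R).
  rewrite /m /minn; case: ifP => _; first by rewrite ler_piMr// ltW.
  exact: ltW.
rewrite ler_nat -[leqLHS]card_ord -(card_imset _ ginj); apply: subset_leq_card.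
apply/fintype.subsetP => _ /imsetP[j _ ->]; rewrite inE -mulrBl normrM normfV.
rewrite (ger0_norm (ltW N0)) ler_pdivrMr// mulrC (le_trans _ kle)//.
have [h1 h2] : (s + j <= i0 + k)%N /\ (i0 <= s + j + k)%N.
  by have := ltn_ord j; rewrite /s /m; split; lia.
have h1' : (s + j)%:R <= i0%:R + k%:R :> R by rewrite -natrD ler_nat.
have h2' : i0%:R <= (s + j)%:R + k%:R :> R by rewrite -natrD ler_nat.
by rewrite /= ler_norml !mulrSr; apply/andP; split; lra.
Qed.

(** For the supremum norm a ball is the product of two one-dimensional balls. *)
Lemma card_nbhd_ge (x0 : grid N) (r : R) : 0 <= r <= 1 ->
  (N%:R * r) ^+ 2 <= #|nbhd x0 r|%:R.
Proof.
move=> r01; have Nr0 : 0 <= N%:R * r by case/andP: r01 => r0 _; rewrite mulr_ge0.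
have -> : nbhd x0 r = finset.setX
    [set i : 'I_N | `|i.+1%:R / N%:R - x0.1.+1%:R / N%:R| <= r]%SET
    [set i : 'I_N | `|i.+1%:R / N%:R - x0.2.+1%:R / N%:R| <= r]%SET.
  by apply/setP => -[i j]; rewrite !inE /gdist prod_normE ge_max.
by rewrite cardsX natrM expr2 ler_pM// card_ball_ord.
Qed.

End neighbourhood.

(** * Moments of the noise *)

Section gaussian_noise.
Context d (T : measurableType d) (R : realType) (P : probability T R).
Context (I : finType) (sigma : R) (eps : I -> {RV P >-> R}).
Context (sigma_gt0 : 0 < sigma) (noise : iid_gaussian sigma eps).
Local Open Scope ereal_scope.

(** Kept unevaluated: it is finite and depends on [sigma] alone, so it can enter the constant of the
    rate. *)
Definition normal_second_moment : R :=
  fine (\int[normal_prob 0 sigma]_x (x ^+ 2)%:E).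

(* [normal_prob] lives on [measurableTypeR R] and the law of a random variable on
   [R]; these carry the same measurable sets under distinct displays, whence
   the detour through the identity. *)
Let idR : measurableTypeR R -> R := idfun.

#[local] HB.instance Definition _ :=
  @isMeasurableFun.Build _ _ _ _ idR (@measurable_id _ _ setT).

Let integral_noise (f : R -> \bar R) i :
  \int[distribution P (eps i)]_x f x =
  \int[distribution (normal_prob 0 sigma) idR]_x f x.
Proof. by apply: eq_measure_integral => A mA _; exact: noise.2. Qed.

Let sigma_neq0 : sigma != 0%R. Proof. by rewrite gt_eqF. Qed.

Let msqr : measurable_fun setT (fun x : R => (x ^+ 2)%:E).
Proof. by apply/measurable_EFinP; exact: measurable_funX. Qed.

Lemma noise_second_moment i :
  \int[P]_t (eps i t ^+ 2)%:E = normal_second_moment%:E.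
Proof.
have <- := @ge0_integral_distribution _ _ _ _ _ P (eps i)
  (fun x => (x ^+ 2)%:E) msqr (fun x => sqr_ge0 x).
rewrite integral_noise ge0_integral_distribution//; last first.
  by move=> x; rewrite lee_fin sqr_ge0.
rewrite fineK// fin_numElt normal_second_moment_lty//.
by rewrite (lt_le_trans (ltNyr 0))// integral_ge0// => x _; rewrite lee_fin sqr_ge0.
Qed.

Let noise_integrable i : P.-integrable setT (EFin \o eps i).
Proof.
apply: integrable_of_sqr; apply/integrableP; split.
  by apply/measurable_EFinP; exact: measurable_funX.
under eq_integral do rewrite gee0_abs ?lee_fin ?sqr_ge0//.
by rewrite noise_second_moment ltry.
Qed.

Lemma noise_mean0 i : \int[P]_t (eps i t)%:E = 0.
Proof.
have mEFin : measurable_fun [set: R] (EFin : R -> \bar R).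
  exact/measurable_EFinP.
rewrite -(@integral_distribution _ _ _ _ _ P (eps i) EFin)//.
rewrite integral_noise integral_distribution//.
  exact: normal_mean0.
exact: normal_integrable_id.
Qed.

Lemma noise_uncorrelated i j : i != j -> \int[P]_t (eps i t * eps j t)%:E = 0.
Proof.
move=> ij; rewrite integralM_indep ?noise_mean0 ?mule0//.
(* Mutual independence is specialised to the pair of indices; [C] assigns [A] to [i] and [B] to
   [j]. *)
- move=> A B mA mB; pose C k := if k == i then A else B.
  have := noise.1 [set i; j]%SET C.
  rewrite (_ : \bigcap_(_ in _) _ = eps i @^-1` A `&` eps j @^-1` B).
    rewrite big_setU1 ?inE//= big_set1 /C eqxx eq_sym (negbTE ij); apply.
    by move=> k _; case: ifP.
  apply/seteqP; split => t /=.
    move=> h; split.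
      by have := h i; rewrite /= !inE eqxx /C eqxx; exact.
    by have := h j; rewrite /= !inE eqxx orbT /C eq_sym (negbTE ij); exact.
  move=> [hi hj] k; rewrite /= !inE /C => /orP[] /eqP ->; first by rewrite eqxx.
  by rewrite eq_sym (negbTE ij).
- apply: integrable_mul_of_sqr; apply/integrableP; (split;
    first by apply/measurable_EFinP; exact: measurable_funX);
  under eq_integral do rewrite gee0_abs ?lee_fin ?sqr_ge0//;
  by rewrite noise_second_moment ltry.
Qed.

End gaussian_noise.

(** * Mean squared error and rate of convergence *)

(** Since the weights sum to 1, [f (gpt R x0)] can be moved inside the sum, and the error becomes a
    deterministic bias plus a weighted sum of noise variables. *)
Lemma expectation_sqr_estimator (R : realType) (N : nat) (sigma h : R)
    (x0 : grid N) (rho : grid N -> R) (f : R * R -> R)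
    (d : measure_display) (T : measurableType d) (P : probability T R)
    (eps : grid N -> {RV P >-> R}) :
  0 < sigma -> 0 < h -> (forall x, x \in nbhd x0 h -> 0 <= rho x) ->
  iid_gaussian sigma eps ->
  ('E_P[fun t => ((estimator sigma h x0 rho
                     (fun x => observation f eps x t) - f (gpt R x0)) ^+ 2)%R] =
   ((\sum_(x in nbhd x0 h) weight sigma (nbhd x0 h) rho x *
        (f (gpt R x) - f (gpt R x0))) ^+ 2 +
    normal_second_moment sigma *
      \sum_(x in nbhd x0 h) weight sigma (nbhd x0 h) rho x ^+ 2)%:E)%E.
Proof.
move=> s0 h0 rho0 noise; set U := nbhd x0 h; set w := weight sigma U rho.
have x0U : x0 \in U by rewrite inE /gdist subrr normr0 ltW.
rewrite -(@expectation_sqr_affine _ _ _ P _ U eps w _ _ (noise_mean0 s0 noise)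
  (noise_second_moment s0 noise) (noise_uncorrelated s0 noise)).
congr expectation; apply/funext => t; congr (_ ^+ 2).
rewrite -[f (gpt R x0) in LHS]mul1r -(weight_sum1 s0 rho0 x0U) mulr_suml -sumrB.
rewrite -big_split/=; apply: eq_bigr => x xU.
by rewrite /observation -/U -/w; ring.
Qed.

Theorem theorem3 (R : realType) (L beta sigma : R)
    (L_gt0 : 0 < L) (beta_gt0 : 0 < beta) (sigma_gt0 : 0 < sigma)
    (c1 cdelta : R) (c1_gt0 : 0 < c1) (cdelta_gt0 : 0 < cdelta) :
  exists C : R, 0 < C /\
    forall (N : nat) (n : R), (0 < N)%N -> n = (N ^ 2)%:R ->
    forall (h : R), 0 < h ->
    (c0 L beta sigma < c1 /\ h = c1 * n `^ (- (1 / (2 * beta + 2)))) \/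
    (exists alpha : R, 0 <= alpha /\ alpha < 1 / (2 * beta + 2) /\
       c1 * n `^ (- alpha) <= h) ->
    forall (f : R * R -> R),
    (forall z : R * R,
       0 <= z.1 <= 1 -> 0 <= z.2 <= 1 -> 0 <= f z) ->
    forall (x0 : grid N),
    (forall x y : grid N, x \in nbhd x0 h -> y \in nbhd x0 h ->
       `| f (gpt R x) - f (gpt R y) | <= L * gdist R x y `^ beta) ->
    forall (delta : R), 0 <= delta ->
    delta <= cdelta * n `^ (- (beta / (2 + 2 * beta))) ->
    forall (rho : grid N -> R),
    (forall x : grid N, x \in nbhd x0 h ->
       rho x = `| f (gpt R x) - f (gpt R x0) | + delta) ->
    forall (d : measure_display) (T : measurableType d) (P : probability T R)
      (eps : grid N -> {RV P >-> R}),
    iid_gaussian sigma eps ->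
    ('E_P[fun t => ((estimator sigma h x0 rho
                       (fun x => observation f eps x t) - f (gpt R x0)) ^+ 2)%R]
      <= (C * n `^ (- (2 * beta / (2 + 2 * beta))))%:E)%E.
Proof.
pose K := normal_second_moment sigma.
(* The cap at 1 keeps [r <= 1], as the counting bound requires; [c <= c1] serves for [r <= h]. *)
pose c := Num.min c1 1.
pose b := L * c `^ beta + cdelta.
have c0' : 0 < c by rewrite lt_min c1_gt0 ltr01.
have c_le1 : c <= 1 by rewrite ge_min lexx orbT.
have s2 : 0 < sigma ^+ 2 by rewrite exprn_gt0.
have b0 : 0 < b by rewrite addr_gt0// mulr_gt0// powR_gt0.
have K0 : 0 <= K.
  by apply/fine_ge0/integral_ge0 => x _; rewrite lee_fin sqr_ge0.
(* The second factor bounds the objective at the competitor in units of [tau ^+ 2]; the first passes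
   from the objective to the mean squared error. *)
exists ((1 + K / sigma ^+ 2) * (b ^+ 2 + sigma ^+ 2 / c ^+ 2)); split.
  apply: mulr_gt0; first by rewrite ltr_wpDr// divr_ge0// ltW.
  by rewrite addr_gt0 ?divr_gt0 ?exprn_gt0.
move=> N n N0 nE h h0 hyp f _ x0 holder delta delta0 deltaE rho rhoE d T P eps
  noise.
set e := 1 / (2 * beta + 2) in hyp.
have e0 : 0 < e by rewrite divr_gt0//; lra.
have n1 : 1 <= n by rewrite nE ler1n expn_gt0 N0.
have n0 : 0 < n by lra.
pose r := c * n `^ (- e).
have r0 : 0 < r by rewrite mulr_gt0// powR_gt0.
have ne_le1 : n `^ (- e) <= 1.
  by rewrite -(powRr0 n); apply: ler_powR => //; lra.
have r1 : r <= 1 by rewrite -[1]mulr1 ler_pM// ?ltW// ?powR_gt0.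
have rh : r <= h.
  have rc1 : r <= c1 * n `^ (- e).
    by rewrite ler_pM2r ?powR_gt0// ge_min lexx.
  case: hyp => [[_ ->]//|[alpha [_ [alphae]]]]; apply: le_trans.
  rewrite (le_trans rc1)// ler_pM2l//; apply: ler_powR => //; lra.
set U := nbhd x0 h; pose V := nbhd x0 r.
have VU x : x \in V -> x \in U by rewrite !inE => /le_trans; apply.
have x0V : x0 \in V by rewrite inE /gdist subrr normr0 ltW.
have x0U := VU _ x0V.
have rho0 x : x \in U -> 0 <= rho x by move=> xU; rewrite rhoE// addr_ge0.
set tau := n `^ (- (beta / (2 + 2 * beta))) in deltaE.
have tau0 : 0 < tau by rewrite powR_gt0.
have -> : n `^ (- (2 * beta / (2 + 2 * beta))) = tau ^+ 2.
  by rewrite -powR_mulrn ?ltW// -powRrM; congr (_ `^ _); field; lra.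
have rbeta : r `^ beta = c `^ beta * tau.
  rewrite powRM ?ltW ?powR_gt0// -powRrM; congr (_ * _ `^ _).
  by rewrite /e; field; lra.
have rhoV x : x \in V -> rho x <= b * tau.
  move=> xV; rewrite rhoE ?VU// /b mulrDl lerD// -mulrA -rbeta.
  rewrite (le_trans (holder _ _ (VU _ xV) x0U))// ler_pM2l//.
  apply: ge0_ler_powR; rewrite ?nnegrE ?normr_ge0 ?(ltW beta_gt0) ?(ltW r0)//.
  by move: xV; rewrite inE.
have cardV : n * r ^+ 2 <= #|V|%:R.
  rewrite nE natrX -exprMn; apply: card_nbhd_ge.
  by rewrite (ltW r0) r1.
(* Balance of bias and variance: the exponents [1], [- 2 e] and [- 2 beta e] add up to 0 for
   [e = 1 / (2 beta + 2)]. *)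
have ntau : n * (n `^ (- e)) ^+ 2 * tau ^+ 2 = 1.
  rewrite -!powR_mulrn ?powR_ge0// /tau -!powRrM -{1}[n](powRr1 (ltW n0)).
  rewrite -!powRD ?(gt_eqF n0) ?implybT//.
  by rewrite -[RHS](powRr0 n); congr (_ `^ _); rewrite /e; field; lra.
have nr2 : n * r ^+ 2 * tau ^+ 2 = c ^+ 2.
  by rewrite -[RHS]mulr1 -ntau /r; ring.
have V0 : 0 < #|V|%:R :> R.
  by rewrite ltr0n; apply/card_gt0P; exists x0.
(* The competitor: uniform weights on [V], extended by 0 to [U]. *)
pose v x : R := if x \in V then #|V|%:R^-1 else 0.
have sumv (g : grid N -> R) : \sum_(x in U) v x * g x =
    (\sum_(x in V) g x) / #|V|%:R.
  rewrite mulr_suml (bigID (fun x => x \in V))/= [X in _ + X]big1 ?addr0; last first.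
    by move=> x /andP[_ /negbTE xV]; rewrite /v xV mul0r.
  rewrite (eq_bigl (fun x => x \in V)); last first.
    by move=> x; apply/andP/idP => [[]//|xV]; split => //; exact: VU.
  by apply: eq_bigr => x xV; rewrite /v xV mulrC.
(* The bias term is the average of [rho] over [V], at most [b * tau]; the sum of squares is
   [1 / #|V|], at most [1 / (n r^2) = tau^2 / c^2]. *)
have risk_v : risk_bound sigma U rho v <=
    (b ^+ 2 + sigma ^+ 2 / c ^+ 2) * tau ^+ 2.
  rewrite /risk_bound sumv mulrDl lerD//.
    rewrite -exprMn ler_sqr ?nnegrE; last 2 first.
    - by rewrite divr_ge0 ?(ltW V0)// sumr_ge0// => x /VU; exact: rho0.
    - by rewrite ltW// mulr_gt0.
    rewrite ler_pdivrMr// mulr_natr -sumr_const; apply: ler_sum => x.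
    exact: rhoV.
  rewrite -mulrA ler_pM2l//.
  under eq_bigr do rewrite expr2.
  rewrite sumv (eq_bigr (fun=> #|V|%:R^-1)); last by move=> x xV; rewrite /v xV.
  rewrite (_ : \sum_(x in V) _ = 1); last first.
    by rewrite sumr_const -[LHS]mulr_natr mulVf// gt_eqF.
  rewrite mul1r -nr2.
  have nr0 : 0 < n * r ^+ 2 by rewrite mulr_gt0// exprn_gt0.
  rewrite invfM -mulrA mulVf ?mulr1 ?gt_eqF ?exprn_gt0//.
  by rewrite lef_pV2 ?posrE.
rewrite expectation_sqr_estimator// lee_fin -/U -/K.
set w := weight sigma U rho.
have w0 x : 0 <= w x by exact: weight_ge0.
have v1 : \sum_(x in U) v x = 1.
  have := sumv (fun=> 1); under eq_bigr do rewrite mulr1.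
  by move=> ->; rewrite sumr_const divff// gt_eqF.
have v0 x : x \in U -> 0 <= v x.
  by move=> _; rewrite /v; case: ifP => // _; rewrite invr_ge0 ltW.
have := le_trans (weight_optimal sigma_gt0 rho0 x0U v0 v1) risk_v.
rewrite /risk_bound -/w; set B := \sum_(x in U) w x * rho x.
set W := \sum_(x in U) w x ^+ 2 => risk_w.
have W0 : 0 <= W by apply: sumr_ge0 => x _; rewrite sqr_ge0.
have bias : (\sum_(x in U) w x * (f (gpt R x) - f (gpt R x0))) ^+ 2 <= B ^+ 2.
  rewrite -real_normK ?num_real// ler_sqr ?nnegrE//; last first.
    by apply: sumr_ge0 => x xU; rewrite mulr_ge0 ?rho0.
  rewrite (le_trans (ler_norm_sum _ _ _))//; apply: ler_sum => x xU.
  by rewrite normrM (ger0_norm (w0 x)) ler_wpM2l// rhoE// lerDl.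
rewrite (le_trans (lerD bias (lexx _)))// -mulrA.
have Ks0 : 0 <= K / sigma ^+ 2 by rewrite divr_ge0// ltW.
apply: le_trans (ler_wpM2l (addr_ge0 ler01 Ks0) risk_w).
(* The expanded product is the bound to be reached plus a nonnegative remainder. *)
have -> : (1 + K / sigma ^+ 2) * (B ^+ 2 + sigma ^+ 2 * W) =
    B ^+ 2 + K * W + (sigma ^+ 2 * W + K / sigma ^+ 2 * B ^+ 2).
  by field; rewrite gt_eqF.
by rewrite lerDl addr_ge0// mulr_ge0// ?sqr_ge0// ltW.
Qed.
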